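(* For every (real) Banach space $E$, the lattice $C_{ph}(B_{E^*})$ satisfies the $\sigma$-bounded chain condition. That is, the set $C_{ph}(B_{E^*})^+$ of nonzero positive elements admits a countable decomposition $C_{ph}(B_{E^*})^+=\bigcup_{n\ge 2}\mathcal{F}_n$ such that, for every $n\ge 2$, every subset $\mathcal{G}\subset\mathcal{F}_n$ with exactly $n$ elements contains two distinct elements $f,g\in\mathcal{G}$ with $f\wedge g\ne 0$.
   Context: $B_{E^*}$ is the closed unit ball of the dual $E^*$ of the real Banach space $E$. $C_{ph}(B_{E^*})$ is the set of all functions $f:B_{E^*}\to\mathbb{R}$ that are weak$^*$-continuous and positively homogeneous, i.e. $f(rx^* )=rf(x^* )$ whenever $r>0$ and $x^*,rx^*\in B_{E^*}$. The order $\le$ and the lattice operations $\wedge,\vee$ are pointwise. $C_{ph}(B_{E^*})^+$ is the set of $f\in C_{ph}(B_{E^*})$ with $f\ge 0$ and $f\neq 0$. *)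

(* Defs.v *)
From mathcomp Require Import all_boot all_order all_algebra.
From mathcomp Require Import all_classical all_reals all_analysis.

Set Implicit Arguments.
Unset Strict Implicit.
Unset Printing Implicit Defensive.

Import Order.TTheory GRing.Theory Num.Theory.
Import numFieldNormedType.Exports.

Local Open Scope classical_set_scope.
Local Open Scope ring_scope.

Definition dual_space (R : realType) (E : normedModType R) : set (E -> R^o) :=
  [set phi : E -> R^o | linear phi /\ continuous phi].
Arguments dual_space {R} E _.

(* The set is nonempty, and it is bounded when phi is in the dual, so that the
   (total) real supremum is then the true one. *)
Definition dual_norm (R : realType) (E : normedModType R) (phi : E -> R^o) : R :=
  sup [set `|phi x| | x in [set x : E | `|x| <= 1]].

(* The elements are taken in {ptws E -> R^o}, so that the topology of the subtype
   dual_ball E is the trace of the product topology, i.e. the coarsest topology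
   that makes all evaluations continuous: the weak* topology. *)
Definition dual_ball (R : realType) (E : normedModType R) :
    set {ptws E -> R^o} :=
  [set phi : {ptws E -> R^o} | dual_space E phi /\ dual_norm phi <= 1].
Arguments dual_ball {R} E _.

(* y ranges over the points of the ball that are of the form r x. *)
Definition pos_homogeneous (R : realType) (E : normedModType R)
    (f : dual_ball E -> R) : Prop :=
  forall (r : R) (x y : dual_ball E), 0 < r ->
    (set_val y : E -> R^o) = r *: (set_val x : E -> R^o) -> f y = r * f x.

Definition Cph (R : realType) (E : normedModType R) : set (dual_ball E -> R) :=
  [set f : dual_ball E -> R | continuous f /\ pos_homogeneous f].
Arguments Cph {R} E _.

Definition nonzero_pos (R : realType) (T : Type) (L : set (T -> R)) :
    set (T -> R) :=
  [set f : T -> R | [/\ L f, forall x, 0 <= f x & f <> cst 0]].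

(* For a lattice L of real functions with the pointwise operations. *)
Definition sigma_bounded_cc (R : realType) (T : Type) (L : set (T -> R)) : Prop :=
  exists F : nat -> set (T -> R),
    nonzero_pos L = \bigcup_(n in [set n | (2 <= n)%N]) F n /\
    forall n, (2 <= n)%N -> forall G : set (T -> R),
      G `<=` F n -> (G #= `I_n)%card ->
      exists f g, [/\ G f, G g, f <> g & f \min g <> cst 0].

(* Main.v *)
(* Let f be nonzero and positive. By homogeneity f is positive at some phi of
   norm at most 1/3, hence on a basic weak* neighbourhood of phi in the ball,
   given by a finite list of vectors. Sort the functions by a bound m on the
   length and on the norms of the list. Among sufficiently many functions of
   the same sort, with data (phi_a, s_a), the pigeonhole principle gives a,
   b, c with a <> c such that phi_b and phi_c almost agree on s_a, while
   phi_a and phi_b almost agree on s_c. Then phi_a - phi_b + phi_c is in the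
   ball, is close to phi_a on s_a and close to phi_c on s_c, so that f_a and
   f_c are both positive at it. *)
From HB Require Import structures.
Require Import Defs.
From mathcomp Require Import all_boot all_order all_algebra.
From mathcomp Require Import all_classical all_reals all_analysis.
From mathcomp Require Import zify lra.

Set Implicit Arguments.
Unset Strict Implicit.
Unset Printing Implicit Defensive.

Import Order.TTheory GRing.Theory Num.Theory.
Import numFieldNormedType.Exports.

Local Open Scope classical_set_scope.
Local Open Scope ring_scope.

(** Greedy choice: take [a] in [A], keep only a largest class of the other [b] for the value of
    [v a b], and iterate. The base [#|C|.+1] instead of [#|C|] pays for the removal of [a]. *)
Lemma end_homogeneous (T C : finType) (v : T -> T -> C) (m : nat)
    (A : {set T}) :
  (#|C|.+1 ^ m <= #|A|)%N ->
  exists (s : seq T) (col : T -> C),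
    [/\ size s = m.+1, uniq s, {subset s <= A} &
        pairwise (fun a b => v a b == col a) s].
Proof.
elim: m A => [|m IHm] A leA.
  have /card_gt0P[a aA] : (0 < #|A|)%N by exact: leq_trans leA.
  exists [:: a], (fun=> v a a); split=> // x.
  by rewrite inE => /eqP->.
have /card_gt0P[a aA] : (0 < #|A|)%N by apply: leq_trans leA; rewrite expn_gt0.
have q_gt0 : (0 < #|C|)%N by apply/card_gt0P; exists (v a a).
pose B c := [set b in A :\ a | v a b == c]%SET.
have [c leB] : exists c, (#|C|.+1 ^ m <= #|B c|)%N.
  apply: contrapT => /forallNP ltB.
  have leAa : (#|A :\ a| <= #|C| * (#|C|.+1 ^ m).-1)%N.
    rewrite -sum1_card (partition_big (v a) predT) //= -sum_nat_const.
    apply: leq_sum => c _.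
    rewrite (_ : (\sum_(i in _ | _) 1)%N = #|B c|).
      by rewrite -ltnS prednK ?expn_gt0 // ltnNge; apply/negP/ltB.
    by rewrite -sum1_card; apply: eq_bigl => b; rewrite !inE.
  move: leA leAa; rewrite (cardsD1 a A) aA expnS.
  have := expn_gt0 #|C|.+1 m; nia.
have [s [col [szs us sB ps]]] := IHm _ leB.
have sA x : x \in s -> [/\ x != a, x \in A & v a x = c].
  by move/sB; rewrite !inE => /andP[/andP[? ?] /eqP].
have nas : a \notin s by apply/negP => /sA[]; rewrite eqxx.
exists (a :: s), (fun x => if x == a then c else col x); split=> /=.
- by rewrite szs.
- by rewrite nas.
- by move=> x; rewrite inE => /predU1P[->|/sA[]].
- apply/andP; split; first by apply/allP => x /sA[_ _ ->]; rewrite !eqxx.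
  rewrite (eq_in_pairwise (P := mem s) (r' := fun a b => v a b == col a)) //.
  by move=> x y /sA[/negPf-> _ _] _.
Qed.

(** In an end-homogeneous sequence of [#|C| + 2] terms, let [c] be the last one. Two of the earlier
    terms, [a] before [b], have the same [v c] by pigeonhole; [v a b = v a c] since [b] and [c] both
    come after [a]. *)
Lemma crossing_triple (T C : finType) (v : T -> T -> C) :
  (#|C|.+1 ^ #|C|.+1 <= #|T|)%N ->
  exists a b c, [/\ a != c, v a b = v a c & v c a = v c b].
Proof.
move=> leT; have := @end_homogeneous T C v #|C|.+1 [set: T]%SET.
rewrite cardsT => /(_ leT)[s [col [+ + _]]].
case/lastP: s => // s c; rewrite size_rcons => -[szs].
rewrite rcons_uniq pairwise_rcons => /andP[ncs us] /andP[/allP pc ps].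
have /(uniqPn (v c c))[i [j [ltij]]] : ~~ uniq (map (v c) s).
  apply/negP => /card_uniqP; rewrite size_map szs => eqsz.
  by have := max_card (mem (map (v c) s)); rewrite eqsz ltnn.
rewrite size_map => ltj; have lti := ltn_trans ltij ltj.
rewrite !(nth_map c) // => eqv.
exists (nth c s i), (nth c s j), c; split=> //.
  by apply: contraNneq ncs => <-; rewrite mem_nth.
have /eqP-> := pairwiseP c ps i j lti ltj ltij.
by have /eqP-> := pc _ (mem_nth c lti).
Qed.

(** A color records, at up to [m] vectors, the integer parts of values in [[-m, m]] shifted by [m],
    hence numbers from [0] to [2m]. *)
Definition colors m : finType := {ffun 'I_m -> 'I_(m + m).+1}.

Definition threshold m : nat := (#|colors m|.+1 ^ #|colors m|.+1)%N.

(** The classes of the decomposition are indexed by cardinality; injectivity recovers the sort [m]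
    from [n = threshold m]. *)
Lemma threshold_inj : injective threshold.
Proof.
have mono : {homo threshold : m n / (m < n)%N}.
  move=> m n ltmn; rewrite /threshold.
  have lt : (#|colors m| < #|colors n|)%N.
    rewrite !card_ffun !card_ord.
    apply: (@leq_ltn_trans ((n + n).+1 ^ m)%N).
      by case: m ltmn => // m ltmn; rewrite leq_exp2r; lia.
    by rewrite ltn_exp2l //; lia.
  by apply: (@leq_ltn_trans (#|colors n|.+1 ^ #|colors m|.+1)%N);
    [rewrite leq_exp2r; lia | rewrite ltn_exp2l //; lia].
by move=> m n eqmn; case: (ltngtP m n) => // /mono; rewrite eqmn ltnn.
Qed.

Lemma threshold_ge2 m : (2 <= threshold m)%N.
Proof.
have : (0 < #|colors m|)%N by rewrite card_ffun !card_ord expn_gt0.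
by rewrite /threshold expnS; have := expn_gt0 #|colors m|.+1 #|colors m|; nia.
Qed.

Section DualBall.
Variables (R : realType) (E : normedModType R).
Implicit Types (phi psi : dual_ball E) (s : seq E).

Local Notation ev phi := (set_val phi : E -> R^o).

Lemma dual_ballP (phi : {ptws E -> R^o}) :
  dual_ball E phi <->
  linear (phi : E -> R^o) /\ forall x, `|phi x| <= `|x|.
Proof.
split=> [[[lin cont] le1]|[lin le]].
  pose L : {linear E -> R^o} := HB.pack (phi : E -> R^o)
    (GRing.isLinear.Build R E R^o *:%R (phi : E -> R^o) lin).
  split=> // x.
  have /linear_boundedP bnd : bounded_near L (nbhs (0 : E)).
    by apply/linear_bounded_continuous.
  have [r [r0 hr]] := pinfty_ex_gt0 bnd.
  (* Continuity enters here: this bound makes [sup] a true supremum, so that [le1] controls every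
     value on the unit ball. *)
  have ub : has_ubound [set `|phi y| | y in [set y : E | `|y| <= 1]].
    exists r => _ [y /= y1 <-]; apply: le_trans (hr y) _.
    by rewrite ler_piMr // ltW.
  have [->|x0] := eqVneq x 0.
    by rewrite -[phi]/(L : E -> R^o) linear0 !normr0.
  have nx : 0 < `|x| by rewrite normr_gt0.
  have : `|phi (`|x|^-1 *: x)| <= 1.
    apply: le_trans le1; apply: ub_le_sup => //.
    exists (`|x|^-1 *: x) => //=.
    by rewrite normrZ normfV normr_id mulVf // gt_eqF.
  rewrite -[phi]/(L : E -> R^o) linearZ /= normrZ normfV normr_id.
  by rewrite ler_pdivrMl // mulr1.
pose L : {linear E -> R^o} := HB.pack (phi : E -> R^o)
  (GRing.isLinear.Build R E R^o *:%R (phi : E -> R^o) lin).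
split; [split=> //|].
  apply: (@bounded_linear_continuous _ _ _ L); apply/linear_boundedP.
  exists 1; split; first exact: num_real.
  by move=> r r1 x; apply: le_trans (le x) _; rewrite ler_peMl // ltW.
apply: ge_sup; first by exists `|phi 0|, 0 => //=; rewrite normr0.
by move=> _ [y /= y1 <-]; apply: le_trans (le y) y1.
Qed.

Lemma dual_ball_linear phi : linear (ev phi).
Proof. by have /dual_ballP[lin le] := set_valP phi; exact: lin. Qed.

Lemma dual_ball_le phi x : `|ev phi x| <= `|x|.
Proof. by have /dual_ballP[lin le] := set_valP phi; exact: le. Qed.

Definition basic_nbhs phi s : set (dual_ball E) :=
  [set psi | forall x, x \in s -> `|ev psi x - ev phi x| < 1].

(* Radius 1 suffices by linearity: testing on [e^-1 *: x] with radius 1 is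
   testing on [x] with radius [e]. *)
Lemma nbhs_basic phi (U : set (dual_ball E)) :
  nbhs phi U -> exists s, basic_nbhs phi s `<=` U.
Proof.
(* Linearity is built into the generating sets, so that convergence of [F] can use the rescaling of
   test vectors. *)
pose F : set_system {ptws E -> R^o} := filter_from setT (fun s : seq E =>
  [set g : {ptws E -> R^o} | linear (g : E -> R^o) /\
     forall x, x \in s -> `|g x - ev phi x| < 1]).
have FF : Filter F.
  apply: filter_from_filter; first by exists [::].
  move=> s t _ _; exists (s ++ t) => // g [ling gst].
  by split; split=> // x xs; apply: gst; rewrite mem_cat xs ?orbT.
have Fphi : F --> (set_val phi : {ptws E -> R^o}).
  (* The product topology is the supremum of the topologies induced by the evaluations, so one
     coordinate [x] at a time suffices. *)
  apply/cvg_sup => x U' [_ [[V Vop <-] Vphi] VU].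
  have /nbhs_ballP[e /= e0 eV] : nbhs (ev phi x) V by exact: open_nbhs_nbhs.
  exists [:: e^-1 *: x] => // g [ling gx]; apply: VU; apply: eV.
  have lins (h : E -> R^o) : linear h -> h (e^-1 *: x) = e^-1 * h x.
    move=> linh; have := linh e^-1 x 0; have := linh 1 0 0.
    rewrite scaler0 !addr0 scale1r => /eqP; rewrite -subr_eq0 opprD addNKr.
    by rewrite oppr_eq0 => /eqP ->; rewrite addr0.
  have := gx _ (mem_head _ _);
  rewrite (lins _ ling) (lins _ (dual_ball_linear phi)).
  rewrite -mulrBr normrM gtr0_norm ?invr_gt0 // ltr_pdivrMl // mulr1.
  by rewrite distrC.
move=> [_ [[V Vop <-] Vphi] VU].
have [s _ sV] : F V by apply: Fphi; exact: open_nbhs_nbhs.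
exists s => psi psis; apply: VU; apply: sV; split=> //.
exact: dual_ball_linear.
Qed.

(* The factor [1/3] keeps [phi_a - phi_b + phi_c] in the unit ball. *)
Definition positive_near (m : nat) (f : dual_ball E -> R) : Prop :=
  exists phi s, [/\ forall x, `|ev phi x| <= 3^-1 * `|x|, (size s <= m)%N,
    forall x, x \in s -> `|x| <= m%:R &
    forall psi, basic_nbhs phi s psi -> 0 < f psi].

Lemma ex_positive_near f : nonzero_pos (Cph E) f -> exists m, positive_near m f.
Proof.
move=> [[fcont fhom] f0 fn0].
have [phi fphi] : exists phi, 0 < f phi.
  apply: contrapT => /forallNP fle; apply: fn0; apply/funext => psi.
  by apply/eqP; rewrite eq_le f0 andbT leNgt; apply/negP/fle.
have third : dual_ball E (3^-1 *: ev phi : E -> R^o).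
  apply/dual_ballP; split=> [a x y|x].
    rewrite /GRing.scale /= dual_ball_linear /GRing.scale /=; lra.
  rewrite normrM gtr0_norm ?invr_gt0 //.
  by apply: le_trans (_ : 3^-1 * `|x| <= _); rewrite ?ler_pM2l ?dual_ball_le;
    have := normr_ge0 x; lra.
pose psi0 : dual_ball E := SigSub (mem_set third).
have psi0E : ev psi0 = 3^-1 *: ev phi by [].
(* Homogeneity keeps [f] positive when [phi] is shrunk. *)
have fpsi0 : 0 < f psi0 by rewrite (fhom 3^-1 phi) ?mulr_gt0 ?invr_gt0.
have [s sU] : exists s, basic_nbhs psi0 s `<=` [set psi | 0 < f psi].
  by apply: nbhs_basic; exact: cvgr_gt (fcont psi0) _ fpsi0.
pose M := \sum_(x <- s) `|x|.
exists (maxn (size s) (Num.truncn M).+1), psi0, s; split=> //.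
- by move=> x; rewrite psi0E normrM gtr0_norm ?invr_gt0 //
    ler_pM2l ?dual_ball_le.
- exact: leq_maxl.
- move=> x xs; apply: (@le_trans _ _ M).
    by rewrite /M (perm_big _ (perm_to_rem xs)) big_cons lerDl sumr_ge0.
  apply: (@le_trans _ _ (Num.truncn M).+1%:R); first exact/ltW/truncnS_gt.
  by rewrite ler_nat leq_maxr.
Qed.

Lemma positive_near_meet m (T : finType) (f : T -> dual_ball E -> R) :
  (threshold m <= #|T|)%N -> (forall a, positive_near m (f a)) ->
  exists a c, a != c /\ exists psi, 0 < f a psi /\ 0 < f c psi.
Proof.
move=> leT /choice[phi] /choice[s fs].
(* The shift by [m] makes the values on [s a] nonnegative and at most [2m], so that neither [truncn]
   nor [inord] returns a default there. Indices past the end of [s a] read the vector [0] and are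
   harmless. *)
pose v a b : colors m :=
  [ffun i : 'I_m => inord (Num.truncn (ev (phi b) (nth 0 (s a) i) + m%:R))].
have vP a b c x : x \in s a -> v a b = v a c ->
    `|ev (phi b) x - ev (phi c) x| < 1.
  have [_ szs les _] := fs a; move=> xs /ffunP eqv.
  have bnd d : 0 <= ev (phi d) x + m%:R /\ ev (phi d) x + m%:R <= (m + m)%:R.
    have := le_trans (dual_ball_le (phi d) x) (les _ xs).
    by rewrite ler_norml natrD => /andP[]; lra.
  have ltx : (index x (s a) < m)%N by apply: leq_trans szs; rewrite index_mem.
  have := eqv (Ordinal ltx); rewrite !ffunE /= nth_index // => /(congr1 val) /=.
  have [b0 bm] := bnd b; have [c0 cm] := bnd c.
  have trm (z : R) : z <= (m + m)%:R -> (Num.truncn z < (m + m).+1)%N.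
    by move=> zm; rewrite ltnS truncn_le_nat (le_lt_trans zm) // ltr_nat.
  rewrite !inordK ?trm // => eqt.
  have /andP[b1 b2] := truncn_itv b0; have /andP[c1 c2] := truncn_itv c0.
  move: b1 b2; rewrite eqt => b1 b2; rewrite -addn1 natrD in b2 c2.
  by rewrite ltr_norml; apply/andP; split; lra.
have [a [b [c [neqac vab vca]]]] := crossing_triple v leT.
have comb : dual_ball E (ev (phi a) - ev (phi b) + ev (phi c) : E -> R^o).
  apply/dual_ballP; split=> [r x y|x].
    rewrite !(fctE, dual_ball_linear) /GRing.scale /=; lra.
  have [/(_ x) ha _ _ _] := fs a; have [/(_ x) hb _ _ _] := fs b.
  have [/(_ x) hc _ _ _] := fs c.
  rewrite !fctE.
  apply: le_trans (ler_normD _ _) _;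
  have := ler_normB (ev (phi a) x) (ev (phi b) x).
  lra.
have [psi psiE] : exists psi, forall x,
    ev psi x = ev (phi a) x - ev (phi b) x + ev (phi c) x.
  by exists (SigSub (mem_set comb)).
exists a, c; split=> //; exists psi.
have [_ _ _ fa] := fs a; have [_ _ _ fc] := fs c.
(* On [s a], [psi - phi a = phi c - phi b] is small by [vab]; on [s c],
   [psi - phi c = phi a - phi b] is small by [vca]. *)
split; [apply: fa|apply: fc] => x xs; rewrite psiE.
  by rewrite addrC -addrA addKr addrC; exact: (vP a c b x xs (esym vab)).
by rewrite addrK; exact: (vP c a b x xs vca).
Qed.

End DualBall.

Theorem theorem1p3 (R : realType) (E : completeNormedModType R) :
  sigma_bounded_cc (Cph E).
Proof.
(* The class is empty when [n] is not a threshold; otherwise [n] elements are just enough for the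
   pigeonhole argument. *)
exists (fun n => [set f | nonzero_pos (Cph E) f /\
  exists2 m, threshold m = n & positive_near m f]); split.
  apply/seteqP; split=> [f fpos|f [n _ []//]].
  have [m fm] := ex_positive_near fpos.
  by exists (threshold m); [exact: threshold_ge2 | split=> //; exists m].
move=> n n2 G GF cardG.
have /card_esym/card_set_bijP[g [gG ginj _]] := cardG.
have gGi (i : 'I_n) : G (g i) by apply: gG; exact: ltn_ord.
have [_ [m mn _]] := GF _ (gGi (Ordinal (ltnW n2))).
have pos (i : 'I_n) : positive_near m (g i).
  by have [_ [m' m'n]] := GF _ (gGi i); rewrite -mn in m'n;
    rewrite -(threshold_inj m'n).
have [|a [c [neq [psi [fa fc]]]]] := positive_near_meet _ pos.
  by rewrite card_ord mn.
exists (g a), (g c); split=> //.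
  move=> /ginj; rewrite !inE /= => /(_ (ltn_ord a) (ltn_ord c)) /val_inj eqac.
  by rewrite eqac eqxx in neq.
move=> /(congr1 (fun h => h psi)) /= /eqP; rewrite gt_eqF //.
by rewrite lt_min fa fc.
Qed.
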